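(* For every fixed graph $H$ there is a constant $h'>0$ such that for every $n$, every $H$-minor-free Boolean circuit computing $\triangle\text{-free}_n$ has at least $h' n^4$ gates, i.e., $\Omega(n^4)$ gates (quadratic in the number of inputs).
   Context: $\triangle\text{-free}_n$ is the Boolean function in the variables $X_{ij}$, $1\le i<j\le n$, that interprets an input as the adjacency matrix of a graph $G$ on vertex set $[n]$ (edge $ij$ present iff $X_{ij}=1$) and outputs $1$ iff $G$ contains no triangle. Boolean circuits have $\land$-, $\lor$- and $\neg$-gates and input gates labelled by variables, and every input variable is the label of at most one input gate (read-once property). A circuit is $H$-minor-free if its underlying undirected graph does not have $H$ as a minor (a minor being a graph obtained by deleting vertices, deleting edges and contracting edges). *)

(* Defs.v *)
From HB Require Import structures.
From mathcomp Require Import all_boot.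

Set Implicit Arguments.
Unset Strict Implicit.
Unset Printing Implicit Defensive.

(** * Finite simple graphs and minors *)

Record sgraph := SGraph {
  vertex :> finType;
  edge : rel vertex;
  edge_sym : symmetric edge;
  edge_irrefl : irreflexive edge }.

Definition sgraph_iso (G1 G2 : sgraph) : Prop :=
  exists2 f : G1 -> G2, bijective f & forall u v, edge (f u) (f v) = edge u v.

Section MinorOperations.
Variable G : sgraph.
Implicit Types x y : G.

Section DelVertex.
Variable x : G.
Definition del_vertex_rel : rel {z : G | z != x} :=
  fun u v => edge (val u) (val v).
Lemma del_vertex_sym : symmetric del_vertex_rel.
Proof. by move=> u v; rewrite /del_vertex_rel edge_sym. Qed.
Lemma del_vertex_irrefl : irreflexive del_vertex_rel.
Proof. by move=> u; rewrite /del_vertex_rel edge_irrefl. Qed.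
Definition del_vertex : sgraph := SGraph del_vertex_sym del_vertex_irrefl.
End DelVertex.

Section DelEdge.
Variables x y : G.
Definition del_edge_rel : rel G :=
  fun u v => edge u v && ((u, v) != (x, y)) && ((u, v) != (y, x)).
Lemma del_edge_sym : symmetric del_edge_rel.
Proof.
move=> u v; rewrite /del_edge_rel edge_sym -!andbA !xpair_eqE; congr (_ && _).
by rewrite andbC [(u == y) && _]andbC [(u == x) && _]andbC.
Qed.
Lemma del_edge_irrefl : irreflexive del_edge_rel.
Proof. by move=> u; rewrite /del_edge_rel edge_irrefl. Qed.
Definition del_edge : sgraph := SGraph del_edge_sym del_edge_irrefl.
End DelEdge.

Section Contract.
Variables x y : G.
(* The vertex resulting from merging [x] and [y] is represented by [x]; loops
   and parallel edges created by the contraction are discarded. *)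
Definition contract_rel : rel {z : G | z != y} :=
  fun u v => (u != v) &&
    [|| edge (val u) (val v),
        (val u == x) && edge y (val v) |
        (val v == x) && edge y (val u)].
Lemma contract_sym : symmetric contract_rel.
Proof.
by move=> u v; rewrite /contract_rel eq_sym edge_sym [X in _ || X]orbC.
Qed.
Lemma contract_irrefl : irreflexive contract_rel.
Proof. by move=> u; rewrite /contract_rel eqxx. Qed.
Definition contract : sgraph := SGraph contract_sym contract_irrefl.
End Contract.

End MinorOperations.

(* [minor H G]: up to isomorphism, [H] is obtained from [G] by a finite
   sequence of deletions and contractions. *)
Inductive minor (H : sgraph) : sgraph -> Prop :=
| minor_iso (G : sgraph) : sgraph_iso H G -> minor H G
| minor_del_vertex (G : sgraph) (x : G) : minor H (del_vertex x) -> minor H G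
| minor_del_edge (G : sgraph) (x y : G) :
    edge x y -> minor H (del_edge x y) -> minor H G
| minor_contract (G : sgraph) (x y : G) :
    edge x y -> minor H (contract x y) -> minor H G.

(** * Boolean circuits *)

Variant gate_label (V : Type) : Type := Input of V | And | Or | Not.
Arguments And {V}.
Arguments Or {V}.
Arguments Not {V}.

(* [wire g h] means that [g] is one of the inputs of [h].  And- and Or-gates
   have arbitrary fan-in; with fan-in 0 they are the constants. *)
Record circuit (V : Type) := Circuit {
  gate : finType;
  label : gate -> gate_label V;
  wire : rel gate;
  output : gate;
  wire_acyclic : forall g h, wire g h -> ~~ connect wire h g;
  fanin_input : forall g h v, label h = Input v -> ~~ wire g h;
  fanin_not : forall h, label h = Not -> #|[set g | wire g h]| = 1;
  read_once : forall g h v, label g = Input v -> label h = Input v -> g = h }.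

Section Circuit.
Variables (V : Type) (C : circuit V).

Definition gate_op (x : V -> bool) (val : gate C -> bool) (h : gate C) : bool :=
  match label h with
  | Input v => x v
  | And => [forall g, wire g h ==> val g]
  | Or => [exists g, wire g h && val g]
  | Not => [forall g, wire g h ==> ~~ val g]
  end.

(* Since [C] is acyclic, [#|gate C|] rounds of updates stabilise all gates
   (lemma [evalE]), whatever the initial values. *)
Definition eval (x : V -> bool) : gate C -> bool :=
  iter #|gate C| (gate_op x) (fun=> false).

Definition computes (f : (V -> bool) -> bool) : Prop :=
  forall x, eval x (output C) = f x.

Lemma eq_gate_op x val1 val2 h :
  (forall g, wire g h -> val1 g = val2 g) ->
  gate_op x val1 h = gate_op x val2 h.
Proof.
rewrite /gate_op => eq_val; case: (label h) => // [||].
- by apply: eq_forallb => g; case: (boolP (wire g h)) => //= /eq_val ->.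
- by apply: eq_existsb => g; case: (boolP (wire g h)) => //= /eq_val ->.
- by apply: eq_forallb => g; case: (boolP (wire g h)) => //= /eq_val ->.
Qed.

Let rank (h : gate C) := #|[set g | connect (@wire _ C) g h]|.

Let rank_lt g h : wire g h -> rank g < rank h.
Proof.
move=> gh; apply/proper_card/properP; split.
  apply/subsetP => k; rewrite !inE => kg.
  exact: connect_trans kg (connect1 gh).
by exists h; rewrite !inE ?connect0 //; apply: wire_acyclic.
Qed.

Let iter_stable x val h m1 m2 : rank h <= m1 -> rank h <= m2 ->
  iter m1 (gate_op x) val h = iter m2 (gate_op x) val h.
Proof.
elim: m1 m2 h => [|m1 IH] [|m2] h //.
- by move=> + _; rewrite leqn0 => /eqP/cards0_eq/setP/(_ h); rewrite !inE connect0.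
- by move=> _; rewrite leqn0 => /eqP/cards0_eq/setP/(_ h); rewrite !inE connect0.
move=> h1 h2 /=; apply: eq_gate_op => g /rank_lt gh.
by apply: IH; rewrite -ltnS; apply: leq_trans gh _.
Qed.

Lemma evalE x h : eval x h = gate_op x (eval x) h.
Proof.
rewrite /eval -[RHS]/(iter #|gate C|.+1 (gate_op x) (fun=> false) h).
by apply: iter_stable; [|apply: leqW]; apply: max_card.
Qed.

Definition underlying_rel : rel (gate C) := fun g h => wire g h || wire h g.

Lemma underlying_sym : symmetric underlying_rel.
Proof. by move=> g h; rewrite /underlying_rel orbC. Qed.

Lemma underlying_irrefl : irreflexive underlying_rel.
Proof.
move=> g; rewrite /underlying_rel orbb; apply/negP => gg.
by have := wire_acyclic gg; rewrite connect0.
Qed.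

Definition underlying_graph : sgraph :=
  SGraph underlying_sym underlying_irrefl.

Definition minor_free (H : sgraph) : Prop := ~ minor H underlying_graph.

End Circuit.

(** * Triangle-freeness *)

(* The variables X_ij with i < j; vertices are numbered from 0. *)
Definition edge_var (n : nat) : finType := {p : 'I_n * 'I_n | p.1 < p.2}.

Definition adjacent n (x : edge_var n -> bool) (i j : 'I_n) : bool :=
  [exists e : edge_var n,
     x e && ((val e == (i, j)) || (val e == (j, i)))].

(* [adjacent x] is irreflexive, so [i], [j] and [k] are pairwise distinct. *)
Definition triangle_free n (x : edge_var n -> bool) : bool :=
  ~~ [exists i, exists j, exists k,
        [&& adjacent x i j, adjacent x j k & adjacent x i k]].

(* Main.v *)
Require Import Defs.
From mathcomp Require Import all_boot all_order all_algebra.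
From mathcomp Require Import reals zify.
Import Order.TTheory GRing.Theory Num.Theory.
Set Implicit Arguments.
Unset Strict Implicit.
Unset Printing Implicit Defensive.

(** By the separator theorem of Alon, Seymour and Thomas, deleting
    [O(sqrt N)] of the [N] gates of an [H]-minor-free circuit leaves only
    components that contain at most half of any prescribed set of input gates,
    so these inputs can be divided evenly between two sides [L] and [R] with no
    wire between them. An assignment leaves a signature of two bits on every
    gate of the separator [X]; the left half of one assignment and the right
    half of another with the same signature can be combined without changing
    the output. Hence a fooling set for the division of the inputs has at most
    [4 ^ #|X|] elements.

    For triangle-freeness take the inputs between two disjoint sets of [m]
    vertices each. An even division has of the order of [m ^ 3] cherries (two
    edges at a common vertex) with one edge on each side. The reflections
    [i |-> s - i] of [Z/m] distribute the pairs of endpoints of cherries over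
    [m] matchings, so some fixed matching closes about [m ^ 2] cherries to
    triangles. The graphs that contain this matching and exactly one edge of
    each of those cherries form a fooling set of size [2 ^ (c * m ^ 2)], so [X]
    has of the order of [m ^ 2] gates, and [N] is at least of the order of
    [m ^ 4]. *)

(** * Connected sets and components *)

Section Connectivity.
Variable G : sgraph.
Implicit Types (S Q X B : {set G}).

(** Connectivity as an induction principle: proofs spread a property along edges instead of handling
    paths. The empty set passes, so nonemptiness is demanded separately. *)
Definition connset S : bool :=
  [forall Q : {set G}, [forall x in S :&: Q,
    [forall a in S :&: Q, forall b in S, edge a b ==> (b \in Q)] ==>
      (S \subset Q)]].

Lemma connsetP S :
  reflect (forall Q x, x \in S -> x \in Q ->
    (forall a b, a \in S -> b \in S -> a \in Q -> edge a b -> b \in Q) ->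
      {subset S <= Q}) (connset S).
Proof.
apply: (iffP forallP) => [cS Q x xS xQ clQ|cS Q].
  apply/subsetP; have /forall_inP/(_ x) := cS Q; rewrite inE xS xQ.
  move/(_ isT)/implyP; apply; apply/forall_inP => a; rewrite inE => /andP[aS aQ].
  by apply/forall_inP => b bS; apply/implyP => /clQ; apply.
apply/forall_inP => x; rewrite inE => /andP[xS xQ]; apply/implyP => clQ.
apply/subsetP; apply: cS xS xQ _ => a b aS bS aQ ab.
move/forall_inP: clQ => /(_ a); rewrite inE aS aQ => /(_ isT).
by move=> /forall_inP/(_ b bS)/implyP/(_ ab).
Qed.

Lemma connset1 x : connset [set x].
Proof.
by apply/connsetP => Q y /set1P-> xQ _ z /set1P->.
Qed.

Lemma connsetU1 S x y : connset S -> x \in S -> edge x y -> connset (y |: S).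
Proof.
move=> /connsetP cS xS xy; apply/connsetP => Q z zS zQ clQ.
have clS a b : a \in S -> b \in S -> a \in Q -> edge a b -> b \in Q.
  by move=> aS bS; apply: clQ; rewrite inE ?aS ?bS orbT.
have xQ : x \in Q.
  case/setU1P: zS zQ => [->|zS] zQ; last exact: cS zS zQ clS _ xS.
  by apply: (clQ y); rewrite ?setU11 // 1?edge_sym // inE xS orbT.
move=> u /setU1P[->|uS]; last exact: cS xS xQ clS _ uS.
by apply: (clQ x) => //; rewrite ?setU11 // inE xS orbT.
Qed.

Definition reach S x : {set G} :=
  [set y | connect [rel a b | [&& a \in S, b \in S & edge a b]] x y].

Lemma reach_refl S x : x \in reach S x.
Proof. by rewrite inE connect0. Qed.

Lemma reach_sub S x : x \in S -> reach S x \subset S.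
Proof.
move=> xS; apply/subsetP => y; rewrite inE => xy.
set r := [rel a b | [&& a \in S, b \in S & edge a b]] in xy.
have cl : closed r [pred a | a \in S].
  by move=> a b /and3P[aS bS _]; rewrite !inE aS bS.
by have := closed_connect cl xy; rewrite !inE xS.
Qed.

Lemma reach_closed S x a b : x \in S -> a \in reach S x -> b \in S ->
  edge a b -> b \in reach S x.
Proof.
move=> xS axS bS ab; have aS := subsetP (reach_sub xS) _ axS.
move: axS; rewrite !inE => xa; apply: connect_trans xa (connect1 _).
by rewrite /= aS bS.
Qed.

Lemma reach_conn S x : x \in S -> connset (reach S x).
Proof.
move=> xS; apply/connsetP => Q y yR yQ clQ z zR.
set r := [rel a b | [&& a \in S, b \in S & edge a b]].
have symr : connect_sym r.
  apply: sym_connect_sym => a b /=.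
  by rewrite edge_sym; case: (a \in S); case: (b \in S).
have half a b : r a b -> a \in reach S x :&: Q -> b \in reach S x :&: Q.
  move=> /and3P[aS bS ab]; rewrite !in_setI => /andP[aR aQ].
  have bR : b \in reach S x by apply: reach_closed ab.
  by rewrite bR (clQ _ _ aR bR aQ ab).
have cl : closed r [pred a | a \in reach S x :&: Q].
  move=> a b ab; apply/idP/idP; apply: half => //.
  by case/and3P: ab => aS bS ab; rewrite /r /= aS bS edge_sym.
have yz : connect r y z.
  move: yR zR; rewrite !inE => xy xz; apply: connect_trans xz.
  by rewrite symr.
have /esym := closed_connect cl yz.
by rewrite -!topredE /= !in_setI yR yQ zR.
Qed.

(** For [S] disjoint from [X]: [S] is a union of components of the graph without [X]. *)
Definition closed_off X S : bool :=
  [forall a in S, forall b, (b \notin X) ==> edge a b ==> (b \in S)].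

Lemma closed_offP X S :
  reflect (forall a b, a \in S -> b \notin X -> edge a b -> b \in S)
          (closed_off X S).
Proof.
apply: (iffP forall_inP) => [cS a b /cS/forallP/(_ b) /implyP cb bX|cS a aS].
  by move/implyP: (cb bX).
by apply/forallP => b; apply/implyP => bX; apply/implyP; apply: cS.
Qed.

Definition component X B : bool :=
  [&& connset B, [disjoint B & X] & closed_off X B].

Lemma reach_component X x : x \notin X -> component X (reach (~: X) x).
Proof.
move=> xX; have xS : x \in ~: X by rewrite inE.
rewrite /component reach_conn //=; apply/andP; split.
  by rewrite disjoints_subset reach_sub.
by apply/closed_offP => a b aR bX; apply: reach_closed => //; rewrite inE.
Qed.

End Connectivity.

(** * Small trees or small cuts *)

Lemma pigeonhole_level (r M : nat) (f : nat -> nat) :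
  0 < r -> \sum_(j < r) f j <= M -> exists2 j, j < r & f j * r <= M.
Proof.
move=> r0 sf; case: (boolP [exists j : 'I_r, f j * r <= M]).
  by case/existsP=> j fj; exists j.
rewrite negb_exists => /forallP fM.
suff: M * r < M * r by rewrite ltnn.
apply: (@leq_ltn_trans ((\sum_(j < r) M))).
  by rewrite sum_nat_const card_ord mulnC.
apply: (@leq_trans (\sum_(j < r) f j * r)); last first.
  by rewrite -big_distrl /= leq_mul2r sf orbT.
have : \sum_(j < r) M.+1 <= \sum_(j < r) f j * r.
  by apply: leq_sum => j _; rewrite ltnNge.
by apply: leq_trans; rewrite !sum_nat_const card_ord ltn_pmul2l.
Qed.

Section TreeOrCut.
Variables (G : sgraph) (B : {set G}) (As : seq {set G}).
Let k := size As.

(* The second component counts how many members of [As], in order, have been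
   visited: these are the balls of the layered graph of Alon, Seymour and
   Thomas, without the layered graph. *)
Let ball (d : nat) : {set G * 'I_k.+1} :=
  [set q : G * 'I_k.+1 | [exists T : {set G},
    [&& T \subset B, connset T, #|T| <= d, q.1 \in T &
        [forall j : 'I_k, (j < q.2) ==> ~~ [disjoint T & nth set0 As j]]]]].

Let ballP d (q : G * 'I_k.+1) : reflect (exists T : {set G},
    [/\ T \subset B, connset T, #|T| <= d, q.1 \in T &
      forall j, j < q.2 -> ~~ [disjoint T & nth set0 As j]]) (q \in ball d).
Proof.
rewrite inE; apply: (iffP existsP) => -[T].
  case/and5P=> TB cT Td qT /forallP AT; exists T; split=> // j jq.
  have jk : j < k by apply: leq_trans jq _; rewrite -ltnS.
  by have /implyP := AT (Ordinal jk); apply.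
case=> TB cT Td qT AT; exists T; rewrite TB cT Td qT /=.
by apply/forallP => j; apply/implyP/AT.
Qed.

Let ball0 : ball 0 = set0.
Proof.
apply/setP => q; rewrite in_set0; apply/negP => /ballP[T [_ _ T0 qT _]].
by move: T0; rewrite leqn0 cards_eq0 => /eqP T0; rewrite T0 inE in qT.
Qed.

Let ball_mono d d' : d <= d' -> ball d \subset ball d'.
Proof.
move=> dd; apply/subsetP => q /ballP[T [TB cT Td qT AT]].
by apply/ballP; exists T; split=> //; apply: leq_trans dd.
Qed.

Let ball_edge d v w i : (v, i) \in ball d -> w \in B -> edge v w ->
  (w, i) \in ball d.+1.
Proof.
move=> /ballP[T [/= TB cT Td vT AT]] wB vw; apply/ballP; exists (w |: T).
split=> /=; rewrite ?setU11 //.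
- by rewrite subUset sub1set wB.
- exact: connsetU1 vw.
- by rewrite cardsU1; case: (w \notin T); rewrite ?add1n // ltnW.
- move=> j /AT; apply: contra; apply: disjointWl; exact: subsetUr.
Qed.

Let ball_visit d v (i i' : 'I_k.+1) : i' = i.+1 :> nat ->
  (v, i) \in ball d -> v \in nth set0 As i -> (v, i') \in ball d.
Proof.
move=> ii /ballP[T [/= TB cT Td vT AT]] vA; apply/ballP; exists T; split=> //= j.
rewrite ii ltnS leq_eqVlt => /orP[/eqP->|/AT//].
by apply/pred0Pn; exists v; rewrite /= vT.
Qed.

(** If [ball r] reaches the last layer, the connected set behind this meets every member of [As].
    Otherwise one of the [r] shells between successive balls is small, and its projection to [G] is
    the cut [Z]. *)
Lemma tree_or_cut r : 0 < r ->
  (exists T : {set G}, [/\ T \subset B, T != set0, connset T, #|T| <= r &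
     forall A, A \in As -> ~~ [disjoint T & A]]) \/
  (exists Z : {set G}, #|Z| * r <= #|G| * (size As).+1 /\
     forall D : {set G}, D != set0 -> connset D -> D \subset B ->
       [disjoint D & Z] -> exists2 A, A \in As & [disjoint D & A]).
Proof.
move=> r0; case: (boolP [exists v, (v, ord_max) \in ball r]).
  case/existsP=> v /ballP[T [/= TB cT Td vT AT]]; left; exists T; split=> //.
    by apply/set0Pn; exists v.
  by move=> A /(nthP set0)[j jk <-]; apply: AT.
rewrite negb_exists => /forallP nov; right.
pose f j := #|ball j.+1 :\: ball j|.
have fS : \sum_(j < r) f j = #|ball r|.
  elim: (r) => [|s IH]; first by rewrite big_ord0 ball0 cards0.
  rewrite big_ord_recr /= IH /f -[RHS](cardsID (ball s)).
  by congr (_ + _); rewrite (setIidPr (ball_mono (leqnSn s))).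
have [|j jr fj] := @pigeonhole_level r (#|G| * k.+1) f r0.
  by rewrite fS; apply: leq_trans (max_card _) _; rewrite card_prod card_ord.
exists [set q.1 | q in ball j.+1 :\: ball j]; split.
  by apply: leq_trans fj; rewrite leq_mul2r leq_imset_card orbT.
move=> D D0 /connsetP cD DB dDZ.
case: (boolP (has (fun A : {set G} => [disjoint D & A]) As)) =>
  [/hasP//|/hasPn nD].
have /set0Pn[b0 b0D] := D0.
(* [D] avoids the projection of the shell, so over [D] the two balls coincide. *)
have shrink b i : b \in D -> (b, i) \in ball j.+1 -> (b, i) \in ball j.
  move=> bD bi; apply: contraTT bD => nbi.
  apply/negP => bD; have /pred0P/(_ b) := dDZ; rewrite /= bD /= => /negP; apply.
  by apply/imsetP; exists (b, i); rewrite // in_setD nbi.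
(* All of [D] lies in [ball j] on every layer: a vertex of [D] in the [m]-th set enters the next
   layer, connectivity spreads this over [D], and [shrink] undoes each increase of the radius. The
   last layer contradicts [nov]. *)
suff all_ball m : m <= k -> forall i : 'I_k.+1, i = m :> nat ->
    forall b, b \in D -> (b, i) \in ball j.
  have := nov b0; rewrite (subsetP (ball_mono (ltnW jr))) //.
  exact: (all_ball k).
elim: m => [_ i i0 b bD|m IH mk i im b bD].
  apply: shrink => //; apply/ballP; exists [set b].
  by rewrite sub1set (subsetP DB) // connset1 cards1 set11 i0; split.
have mk1 : m < k.+1 by rewrite ltnS ltnW.
have /pred0Pn[a /andP[/= aD aA]] := nD _ (mem_nth set0 mk).
have ai : (a, i) \in ball j.
  by apply: (@ball_visit j a (Ordinal mk1) i) => //; apply: IH => //; apply: ltnW.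
have := cD [set c | (c, i) \in ball j] a aD; rewrite in_set => /(_ ai) sub.
suff /sub/(_ b bD) : forall a0 b1, a0 \in D -> b1 \in D ->
    a0 \in [set c | (c, i) \in ball j] -> edge a0 b1 ->
    b1 \in [set c | (c, i) \in ball j] by rewrite in_set.
move=> u w uD wD; rewrite [u \in _]in_set [w \in _]in_set => ui uw.
by apply: shrink => //; apply: ball_edge uw => //; apply: (subsetP DB).
Qed.
End TreeOrCut.

(** * The separator theorem *)

Section Separator.
Variables (G : sgraph) (K : finType) (gam : K -> G).
Implicit Types (S X B C D Z T : {set G}) (CC : {set {set G}}).

Definition touching C D := exists a b, [/\ a \in C, b \in D & edge a b].

(** The branch sets of a complete minor on [#|CC|] vertices. *)
Definition covey CC : Prop :=
  (forall C, C \in CC -> connset C /\ C != set0) /\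
  (forall C D, C \in CC -> D \in CC -> C != D ->
     [disjoint C & D] /\ touching C D).

Definition heavy X B : bool :=
  component X B && (#|K| < 2 * #|gam @^-1: B|).

Lemma componentP X B : reflect
  [/\ connset B, [disjoint B & X] &
      forall a b, a \in B -> b \notin X -> edge a b -> b \in B]
  (component X B).
Proof.
apply: (iffP and3P) => -[cB dB cl]; split=> //; first exact/closed_offP.
exact/closed_offP.
Qed.

Lemma heavy_meet X Y B D : heavy X B -> heavy Y D -> ~~ [disjoint B & D].
Proof.
move=> /andP[_ wB] /andP[_ wD]; apply/negP => BD.
have : #|gam @^-1: B| + #|gam @^-1: D| <= #|K|.
  have BD0 : [disjoint gam @^-1: B & gam @^-1: D].
    apply/pred0P => x /=; rewrite !inE.
    by have /pred0P/(_ (gam x)) := BD.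
  rewrite -cardsUI (_ : _ :&: _ = set0) ?cards0 ?addn0 ?max_card //.
  exact/disjoint_setI0.
lia.
Qed.

Lemma heavy_neq0 X B : heavy X B -> B != set0.
Proof.
move=> /andP[_]; case: (eqVneq B set0) => // ->.
by rewrite preimset0 cards0 muln0.
Qed.

(** Each set carries more than half of the weight, so they meet; [D] is connected and avoids [X], so
    it cannot leave [B]. *)
Lemma heavy_sub X Y B D : heavy X B -> heavy Y D -> X \subset Y -> D \subset B.
Proof.
move=> hB hD XY; have /pred0Pn[x /andP[/= xB xD]] := heavy_meet hB hD.
have /andP[/componentP[_ dB clB] _] := hB.
have /andP[/componentP[/connsetP cD dD _] _] := hD.
apply/subsetP/(cD _ x) => // a b aD bD aB; apply: clB => //.
by apply/negP => /(subsetP XY); rewrite (disjointFr dD bD).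
Qed.

(** * A covey of [h] sets from heavy components behind all small sets *)

Variables (r h : nat).
Hypothesis r_gt0 : 0 < r.
Hypothesis hGr : h * #|G| <= r ^ 2.
Hypothesis haven : forall X, #|X| <= h * r -> exists B, heavy X B.

Definition nbhd B C : {set G} := [set v in B | [exists c in C, edge c v]].

(* Branch sets may be large; only their traces on [X] are bounded. *)
Definition state CC X B : Prop :=
  [/\ covey CC,
      forall C, C \in CC -> [disjoint C & B] /\ #|X :&: C| <= r,
      X \subset cover CC & heavy X B].

(** The factor 3 pays for a new branch set of [t > 0] vertices: the first two terms rise by at most
    [1 + t], while [B] loses at least [t] vertices. *)
Definition potential CC X B := #|CC| + #|X| + 3 * #|B|.

Lemma state_card CC X B : state CC X B -> #|X| <= #|CC| * r.
Proof.
case=> _ sC XC _; rewrite -sum_nat_const.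
apply: (@leq_trans (\sum_(C in CC) #|X :&: C|)); last first.
  by apply: leq_sum => C /sC[].
apply: (@leq_trans #|\bigcup_(C in CC) (X :&: C)|).
  apply: subset_leq_card; apply/subsetP => x xX.
  have /bigcupP[C CC1 xC] := subsetP XC _ xX.
  by apply/bigcupP; exists C; rewrite // inE xX.
apply: (big_ind2 (fun (S : {set G}) m => #|S| <= m)) => //.
  by rewrite cards0.
by move=> S1 m1 S2 m2 l1 l2; apply: leq_trans (leq_card_setU _ _) (leq_add l1 l2).
Qed.

Lemma covey_sub CC CC' : CC' \subset CC -> covey CC -> covey CC'.
Proof.
move=> /subsetP sub [c1 c2]; split=> [C /sub/c1//|C D /sub CC1 /sub DC].
exact: c2.
Qed.

Lemma covey_add CC D : covey CC -> connset D -> D != set0 ->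
  (forall C, C \in CC -> [disjoint D & C] /\ touching D C) -> covey (D |: CC).
Proof.
move=> [c1 c2] cD D0 DC; split=> [C /setU1P[->//|/c1//]|].
have symm C C' : [disjoint C & C'] /\ touching C C' ->
    [disjoint C' & C] /\ touching C' C.
  rewrite disjoint_sym => -[-> [a [b [aC bC ab]]]]; split=> //.
  by exists b, a; rewrite edge_sym.
move=> C C' /setU1P[->|CC1] /setU1P[->|CC2]; rewrite ?eqxx // => neq.
- exact: DC.
- exact/symm/DC.
- exact: c2.
Qed.

(** Releasing the vertices of [C] from [X] cannot enlarge [B], as none of them is adjacent to
    [B]. *)
Lemma state_drop CC X B C : state CC X B -> C \in CC -> nbhd B C = set0 ->
  state (CC :\ C) (X :\: C) B.
Proof.
move=> [cov sC XC /andP[/componentP[cB dB clB] wB]] CC1 nb; split.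
- by apply: covey_sub cov; apply: subD1set.
- move=> D /setD1P[_ /sC[DB XD]]; split=> //; apply: leq_trans XD.
  by apply: subset_leq_card; rewrite setSI ?subsetDl.
- apply/subsetP => x /setDP[/(subsetP XC)/bigcupP[D DC xD] xC].
  apply/bigcupP; exists D => //; rewrite in_setD1 DC andbT.
  by apply: contraNneq xC => <-.
apply/andP; split=> //; apply/componentP; split=> //.
  by apply: disjointWr dB; apply: subsetDl.
move=> a b aB bX ab; apply: clB (aB) _ (ab); apply: contra bX => bX.
rewrite in_setD bX andbT; apply/negP => bC.
have := in_set0 a; rewrite -nb inE aB /= => /negbT/negP; apply.
by apply/exists_inP; exists b; rewrite // edge_sym.
Qed.

(** [T] becomes a branch set and joins [X] as a whole. There is room for it because [X] has at most
    [#|CC| * r] elements. *)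
Lemma state_add CC X B T : state CC X B -> #|CC| < h -> T \subset B ->
  T != set0 -> connset T -> #|T| <= r ->
  (forall C, C \in CC -> ~~ [disjoint T & nbhd B C]) ->
  exists CC' X' B', state CC' X' B' /\ potential CC' X' B' < potential CC X B.
Proof.
move=> st CCh TB T0 cT Tr TC; have [cov sC XC hB] := st.
have XT : #|X :|: T| <= h * r.
  apply: leq_trans (leq_card_setU _ _) _.
  apply: (@leq_trans (#|CC|.+1 * r)); last by rewrite leq_mul2r CCh orbT.
  by rewrite mulSn addnC leq_add // (state_card st).
have [B' hB'] := haven XT; exists (T |: CC), (X :|: T), B'.
have B'B : B' \subset B by apply: heavy_sub hB hB' _; apply: subsetUl.
have B'T : [disjoint B' & T].
  have /andP[/componentP[_ dB' _] _] := hB'.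
  by apply: disjointWr dB'; apply: subsetUr.
have dCT C : C \in CC -> [disjoint T & C].
  by case/sC => + _; rewrite disjoint_sym; apply: disjointWl.
split; last first.
  have : #|B'| + #|T| <= #|B|.
    rewrite -cardsUI (disjoint_setI0 B'T) cards0 addn0 subset_leq_card //.
    by rewrite subUset B'B.
  have : 0 < #|T| by rewrite card_gt0.
  have : #|X :|: T| <= #|X| + #|T| := leq_card_setU X T.
  have : #|T |: CC| <= #|CC|.+1 by rewrite cardsU1; case: (T \notin CC).
  rewrite /potential.
  move: #|X :|: T| #|T |: CC| #|T| #|B'| #|B| #|X| #|CC|; clear; lia.
split=> //.
- apply: covey_add => // C CC1; split; first exact: dCT.
  have /pred0Pn[v /andP[/= vT]] := TC _ CC1.
  rewrite inE => /andP[_ /exists_inP[c cC cv]].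
  by exists v, c; rewrite edge_sym.
- move=> C /setU1P[->|CC1].
    rewrite disjoint_sym; split=> //; apply: leq_trans Tr.
    by apply: subset_leq_card; apply: subsetIr.
  have [CB XCr] := sC _ CC1; split; first exact: disjointWr CB.
  rewrite setIUl (disjoint_setI0 (dCT _ CC1)) setU0 //.
- rewrite subUset; apply/andP; split.
    apply: subset_trans XC _; apply/subsetP => x /bigcupP[C CC1 xC].
    by apply/bigcupP; exists C; rewrite // setU1r.
  by apply: bigcup_sup; apply: setU11.
Qed.

(* [D], the new branch set, is what [C] reaches outside the new heavy component
   [B0]; the part of the cut inside [D] replaces the part of [X] inside [C]. *)
Lemma state_grow CC X B C Z B0 : state CC X B -> C \in CC ->
  #|Z| <= r -> #|(X :\: C) :|: Z| <= h * r -> nbhd B C != set0 ->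
  heavy (X :|: Z) B0 -> [disjoint B0 & nbhd B C] ->
  exists CC' X' B', state CC' X' B' /\ potential CC' X' B' < potential CC X B.
Proof.
move=> [cov sC XC hB] CC1 Zr XZr nb0 hB0 B0nb.
have /andP[/componentP[cB dBX clB] wB] := hB.
have /andP[/componentP[cB0 dB0 clB0] wB0] := hB0.
have B0B : B0 \subset B by apply: heavy_sub hB hB0 _; apply: subsetUl.
have [dCB XCr] := sC _ CC1.
have [cC C0] := cov.1 _ CC1; have /set0Pn[c0 c0C] := C0.
pose S := C :|: (B :\: B0); pose D := reach S c0.
have c0S : c0 \in S by rewrite in_setU c0C.
have DS : D \subset S by apply: reach_sub.
have clD a b : a \in D -> b \in S -> edge a b -> b \in D by apply: reach_closed.
have CD : C \subset D.
  apply/subsetP; move/connsetP: cC => /(_ D c0 c0C).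
  apply; first exact: reach_refl.
  by move=> a b _ bC aD; apply: clD => //; rewrite in_setU bC.
have B0D : [disjoint B0 & D].
  apply: disjointWr DS _; apply/pred0P => x /=; rewrite !inE.
  case xB0 : (x \in B0); rewrite //= orbF.
  by rewrite (disjointFl dCB) ?(subsetP B0B).
pose X' := (X :\: C) :|: (D :&: Z :&: B).
have X'sub : X' \subset X :|: Z.
  apply/subsetP => x; rewrite !inE.
  by case/orP=> [/andP[_ ->]|/andP[/andP[_ ->] _]]; rewrite ?orbT.
have [|B' hB'] := haven (X := X').
  apply: leq_trans XZr; apply: subset_leq_card; apply: setUS.
  by rewrite -setIA; apply: subset_trans (subsetIr _ _) (subsetIl _ _).
have B0B' : B0 \subset B' by apply: heavy_sub hB' hB0 _.
have /andP[/componentP[/connsetP cB' dB' clB'] wB'] := hB'.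
have /set0Pn[b0 b0B0] := heavy_neq0 hB0.
(* Walk inside [B'] from [B0]. A first step into [D] would start in [B0], since the rest of [B] next
   to [D] is absorbed by [D]. It cannot end in [C], whose neighbourhood misses [B0], nor in
   [B :\: B0], which is cut off from [B0] by [Z]. *)
have B'sub : B' \subset B :\: D.
  apply/subsetP; apply: (cB' _ b0); first exact: (subsetP B0B').
    by rewrite in_setD (subsetP B0B) // andbT (disjointFr B0D).
  move=> a b aB' bB' /setDP[aB aD] ab.
  have bX' : b \notin X' by rewrite (disjointFr dB').
  have bD : b \notin D.
    apply/negP => bD; have aB0 : a \in B0.
      apply: contraNT aD => aB0; apply: clD bD _ _; last by rewrite edge_sym.
      by rewrite in_setU in_setD aB0 aB orbT.
    have [bC|bC] := boolP (b \in C).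
      have := disjointFr B0nb aB0; rewrite inE aB /= => /negbT/negP; apply.
      by apply/exists_inP; exists b; rewrite // edge_sym.
    have := subsetP DS _ bD; rewrite in_setU (negbTE bC) in_setD => /andP[bB0 bB].
    case/negP: bB0; apply: clB0 aB0 _ ab; rewrite in_setU (disjointFr dBX bB) /=.
    by move: bX'; rewrite in_setU !in_setI bD bB andbT => /norP[].
  rewrite in_setD bD; apply: clB aB _ ab.
  have bC : b \notin C by apply: contra bD; apply: (subsetP CD).
  by move: bX'; rewrite in_setU in_setD bC => /norP[].
have CC'D : [disjoint D & B'].
  rewrite disjoint_sym; apply: disjointWl B'sub _.
  by rewrite disjoints_subset subDset setUCr subsetT.
exists (D |: (CC :\ C)), X', B'; split; last first.
  (* A neighbour of [C] in [B] lies outside [B0] and is absorbed by [D]; this makes the loss of [B]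
     strict. *)
  have /set0Pn[v vnb] := nb0.
  have vD : v \in D :&: B.
    have vB0 : v \notin B0 by rewrite (disjointFl B0nb).
    move: vnb; rewrite inE => /andP[vB /exists_inP[c cInC cv]].
    rewrite in_setI vB andbT; apply: clD (subsetP CD _ cInC) _ cv.
    by rewrite in_setU in_setD vB vB0 orbT.
  have DB0 : 0 < #|D :&: B| by apply/card_gt0P; exists v.
  have c1 : #|B'| + #|D :&: B| <= #|B|.
    by rewrite addnC -(cardsID D B) setIC leq_add2l subset_leq_card.
  have c2 : #|D |: (CC :\ C)| <= #|CC|.
    rewrite cardsU1 [X in _ <= X](cardsD1 C) CC1.
    by case: (D \notin _); rewrite //= leqnSn.
  have c3 : #|X'| <= #|X| + #|D :&: B|.
    apply: leq_trans (leq_card_setU _ _) _.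
    rewrite leq_add ?subset_leq_card ?subsetDl //.
    by rewrite setSI ?subsetIl.
  rewrite /potential.
  move: #|X'| #|D |: (CC :\ C)| #|D :&: B| #|B'| #|B| #|X| #|CC|
    c1 c2 c3 DB0; clear; lia.
have dDC C' : C' \in CC :\ C -> [disjoint D & C'].
  move=> /setD1P[neq C'C]; have [dC'B _] := sC _ C'C.
  apply: disjointWl DS _; rewrite disjoints_subset subUset.
  rewrite -!disjoints_subset disjoint_sym ((cov.2 _ _ C'C CC1 neq).1) /=.
  by apply: disjointWl (subsetDl _ _) _; rewrite disjoint_sym.
split=> //.
- apply: covey_add.
  + by apply: covey_sub cov; apply: subD1set.
  + exact: reach_conn.
  + by apply/set0Pn; exists c0; apply: reach_refl.
  + move=> C' C'C; split; first exact: dDC.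
    move/setD1P: C'C; rewrite eq_sym => -[neq C'C].
    have [_ [a [b [aC bC ab]]]] := cov.2 _ _ CC1 C'C neq.
    by exists a, b; rewrite (subsetP CD).
- move=> C' /setU1P[->|C'C].
    split=> //; apply: leq_trans Zr; apply: subset_leq_card.
    apply/subsetP => x; rewrite in_setI in_setU => /andP[/orP[/setDP[xX xC]|]].
      move/(subsetP DS); rewrite in_setU (negbTE xC) in_setD => /andP[_ xB].
      by rewrite (disjointFr dBX xB) in xX.
    by rewrite !in_setI => /andP[/andP[_ ->]].
  have dD := dDC _ C'C; case/setD1P: C'C => neq C'C.
  have [C'B XC'] := sC _ C'C; split.
    by apply: disjointWr C'B; apply: subset_trans B'sub (subsetDl _ _).
  apply: leq_trans XC'; apply: subset_leq_card.
  apply/subsetP => x; rewrite !in_setI in_setU => /andP[+ xC'].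
  rewrite xC' andbT => /orP[/setDP[]//|]; rewrite !in_setI => /andP[/andP[xD]].
  by rewrite (disjointFr dD xD) in xC'.
- rewrite subUset; apply/andP; split.
    apply/subsetP => x /setDP[/(subsetP XC)/bigcupP[C' C'C xC'] xC].
    apply/bigcupP; exists C' => //; rewrite setU1r // in_setD1 C'C andbT.
    by apply: contraNneq xC => <-.
  apply/subsetP => x; rewrite !in_setI => /andP[/andP[xD _] _].
  by apply/bigcupP; exists D; rewrite // setU11.
Qed.

(** A branch set without neighbours in [B] is dropped. Otherwise [tree_or_cut], applied to the
    neighbourhoods, gives a new branch set or a cut; beyond the cut the heavy component misses some
    neighbourhood, and that branch set grows. *)
Lemma state_step CC X B : state CC X B -> #|CC| < h ->
  exists CC' X' B', state CC' X' B' /\ potential CC' X' B' < potential CC X B.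
Proof.
move=> st CCh; have [cov sC XC hB] := st.
case: (boolP [exists C in CC, nbhd B C == set0]).
  case/exists_inP=> C CC1 /eqP nb.
  exists (CC :\ C), (X :\: C), B; split; first exact: state_drop.
  rewrite /potential ltn_add2r [X in _ < X + _](cardsD1 C) CC1 ltnS.
  by rewrite leq_add2l subset_leq_card // subsetDl.
rewrite negb_exists => /forallP nb.
pose As := [seq nbhd B C | C <- enum CC].
have sAs : (size As).+1 = #|CC|.+1 by rewrite size_map -cardE.
have [[T [TB T0 cT Tr TA]]|[Z [Zr ZD]]] := tree_or_cut B As r_gt0.
  apply: (state_add st CCh TB T0 cT Tr) => C CC1.
  by apply: TA; apply: map_f; rewrite mem_enum.
(* [#|Z| * r <= #|G| * #|CC|.+1 <= #|G| * h <= r ^ 2]. *)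
have {}Zr : #|Z| <= r.
  rewrite -(leq_pmul2r r_gt0); apply: leq_trans Zr _.
  by rewrite mulnn sAs; apply: leq_trans hGr; rewrite mulnC leq_mul2r CCh orbT.
have XZr : #|X :|: Z| <= h * r.
  apply: leq_trans (leq_card_setU _ _) _.
  apply: (@leq_trans (#|CC|.+1 * r)); last by rewrite leq_mul2r CCh orbT.
  by rewrite mulSn addnC leq_add // (state_card st).
have [B0 hB0] := haven XZr.
have B0B : B0 \subset B by apply: heavy_sub hB hB0 _; apply: subsetUl.
have /andP[/componentP[cB0 dB0 _] _] := hB0.
have [|A] := ZD B0 (heavy_neq0 hB0) cB0 B0B.
  by apply: disjointWr dB0; apply: subsetUr.
case/mapP=> C; rewrite mem_enum => CC1 -> dC.
apply: (state_grow st CC1 Zr _ _ hB0 dC).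
  by apply: leq_trans XZr; apply: subset_leq_card; rewrite setSU ?subsetDl.
by have := nb C; rewrite CC1.
Qed.

(** The potential cannot decrease forever, so [state_step] must run out of states with fewer than
    [h] branch sets. *)
Lemma large_covey : exists CC, covey CC /\ h <= #|CC|.
Proof.
have [B hB] : exists B, heavy set0 B by apply: haven; rewrite cards0.
have st : state set0 set0 B.
  split=> //; rewrite ?sub0set //; last by move=> C; rewrite inE.
  by split=> [C|C D]; rewrite inE.
suff main m : forall CC X B, state CC X B -> potential CC X B < m ->
    exists CC, covey CC /\ h <= #|CC| by apply: main st (ltnSn _).
elim: m => // m IH {B hB st} CC X B st pot.
have [hCC|CCh] := leqP h #|CC|; first by exists CC; case: st.
have [CC' [X' [B' [st' lt']]]] := state_step st CCh.
by apply: IH st' _; apply: leq_trans lt' _.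
Qed.

End Separator.

(** * Light separators and balanced divisions *)

Section Split.
Variables (G : sgraph) (K : finType) (gam : K -> G).

Lemma light_separator (r h : nat) : 0 < r -> h * #|G| <= r ^ 2 ->
  (forall CC : {set {set G}}, covey CC -> #|CC| < h) ->
  exists X : {set G}, #|X| <= h * r /\ forall B, ~~ heavy gam X B.
Proof.
move=> r0 hG nc.
case: (boolP [exists X : {set G},
    (#|X| <= h * r) && [forall B, ~~ heavy gam X B]]).
  by case/existsP=> X /andP[Xr /forallP hX]; exists X.
rewrite negb_exists => /forallP hX.
have [|CC [/nc]] := @large_covey G K gam r h r0 hG;
  last by rewrite ltnNge => /negbTE->.
move=> X Xr; have := hX X; rewrite Xr negb_forall => /existsP[B].
by rewrite negbK; exists B.
Qed.

Let weight (S : {set G}) := #|gam @^-1: S|.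

Let weightU (S T : {set G}) : [disjoint S & T] ->
  weight (S :|: T) = weight S + weight T.
Proof.
move=> ST; rewrite /weight preimsetU -cardsUI -preimsetI.
by rewrite (disjoint_setI0 ST) preimset0 cards0 addn0.
Qed.

(** Take [L] of maximal weight among the unions of components with at most half of the weight. Were
    it below a quarter, another component of positive weight could be added: by maximality that
    component weighs no more than [L], so the union stays below half. *)
Lemma balanced_split (X : {set G}) : injective gam ->
  (forall B, ~~ heavy gam X B) -> 4 * #|X| <= #|K| ->
  exists L : {set G}, [/\ [disjoint L & X], closed_off X L,
    #|K| <= 4 * #|gam @^-1: L| & #|K| <= 4 * #|gam @^-1: ~: (L :|: X)|].
Proof.
move=> gam_inj light XK.
pose P (L : {set G}) :=
  [&& closed_off X L, [disjoint L & X] & 2 * weight L <= #|K|].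
have P0 : P set0.
  rewrite /P /weight preimset0 cards0 muln0 /= andbT; apply/andP; split.
    by apply/closed_offP => a b; rewrite inE.
  by rewrite disjoints_subset sub0set.
case: (arg_maxnP weight P0) => L /and3P[clL LX wL] maxL.
have wX : weight X <= #|X|.
  rewrite /weight -(card_imset _ gam_inj) subset_leq_card //.
  by apply/subsetP => x /imsetP[k + ->]; rewrite inE.
have wtot : weight L + weight X + weight (~: (L :|: X)) = #|K|.
  rewrite -(weightU LX) -weightU; last by rewrite disjoints_subset setCK.
  by rewrite setUCr /weight preimsetT cardsT.
exists L; split=> //; rewrite -!/(weight _); last by lia.
case: (leqP #|K| (4 * weight L)) => // wL4.
have : 0 < weight (~: (L :|: X)) by lia.
rewrite card_gt0 => /set0Pn[k]; rewrite !inE => /norP[kL kX].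
pose B := reach (~: X) (gam k).
have cB : component X B by apply: reach_component.
have kB : gam k \in B by apply: reach_refl.
have : ~~ (#|K| < 2 * weight B) by have := light B; rewrite /heavy cB.
rewrite -leqNgt => wB.
have /componentP[/connsetP conB BX clB] := cB.
have PB : P B by rewrite /P BX wB; case/and3P: cB => _ _ ->.
have BL : [disjoint L & B].
  rewrite disjoint_sym disjoints_subset.
  apply/subsetP; apply: (conB _ (gam k)) => //.
    by rewrite inE.
  move=> a b aB bB; rewrite !in_setC => aL ab; apply: contra aL => bL.
  have aX : a \notin X by rewrite (disjointFr BX).
  by apply: (closed_offP _ _ clL) bL aX _; rewrite edge_sym.
have := maxL _ PB; have := maxL (L :|: B).
rewrite /P weightU //.
have -> : closed_off X (L :|: B).
  apply/closed_offP => a b /setUP[aL|aB] bX ab; rewrite in_setU.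
    by rewrite (closed_offP _ _ clL _ _ aL bX ab).
  by rewrite (clB a) // orbT.
have -> : [disjoint L :|: B & X].
  by rewrite disjoints_subset subUset -!disjoints_subset LX BX.
have : 0 < weight B by rewrite card_gt0; apply/set0Pn; exists k; rewrite inE.
rewrite /geq /= => B0 mLB mB.
case: (leqP (2 * (weight L + weight B)) #|K|) => [/mLB|]; lia.
Qed.
End Split.

(** * Minors from branch sets *)

(* [f] sends a vertex to the vertex of [H] whose branch set contains it. *)
Definition model (H G : sgraph) (f : G -> option H) : Prop :=
  (forall u, connset [set x | f x == Some u] /\ exists x, f x = Some u) /\
  (forall u v, edge u v ->
     exists x y, [/\ f x = Some u, f y = Some v & edge x y]).

(** Delete the surplus edges one at a time until [g] is an isomorphism. *)
Lemma spanning_minor (H G : sgraph) (g : H -> G) : bijective g ->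
  (forall u v, edge u v -> edge (g u) (g v)) -> minor H G.
Proof.
have [m] := ubnP #|[set p : G * G | edge p.1 p.2]|.
elim: m G g => // m IH G g ltm [g' gK g'K] ge.
case: (boolP [exists p : G * G, edge p.1 p.2 && ~~ edge (g' p.1) (g' p.2)]).
  case/existsP=> -[x y] /= /andP[xy nxy].
  apply: (@minor_del_edge _ _ x y) => //.
  apply: (IH (del_edge x y) g); last 1 first.
  - move=> u v uv; rewrite /edge /= /del_edge_rel ge //= !xpair_eqE.
    apply/andP; split; apply/negP => /andP[/eqP gu /eqP gv]; case/negP: nxy.
      by rewrite -gu -gv !gK.
    by rewrite -gu -gv !gK edge_sym.
  - rewrite -ltnS; apply: leq_trans ltm; rewrite ltnS.
    apply: proper_card; apply/properP; split.
      by apply/subsetP => -[a b]; rewrite !inE /= => /andP[/andP[->]].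
    by exists (x, y); rewrite !inE // /edge /= /del_edge_rel eqxx /= andbF.
  - by exists g'.
rewrite negb_exists => /forallP nex.
apply: minor_iso; exists g; first by exists g'.
move=> u v; apply/idP/idP; last exact: ge.
move=> guv; have := nex (g u, g v); rewrite /= guv /= negbK.
by rewrite !gK.
Qed.

(** Induction on [#|G|]: delete a vertex outside all branch sets, or contract an edge inside one.
    When neither exists, [H] spans [G]. *)
Lemma model_minor (H G : sgraph) (f : G -> option H) : model f -> minor H G.
Proof.
have [m] := ubnP #|G|; elim: m G f => // m IH G f ltm [fc fe].
case: (boolP [exists x, f x == None]) => [/existsP[x /eqP fx]|].
  apply: (@minor_del_vertex _ _ x).
  have neqx a u : f a = Some u -> a != x.
    by move=> fa; apply/eqP => ax; rewrite ax fx in fa.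
  apply: (IH (del_vertex x) (fun z => f (val z))).
    rewrite card_sig -ltnS; apply: leq_trans ltm; rewrite ltnS.
    apply: proper_card; apply/properP.
    by split; [apply/subsetP|exists x; rewrite ?inE ?eqxx].
  split=> [u|u v uv].
    have [/connsetP cu [a fa]] := fc u; split; last first.
      by exists (Sub a (neqx _ _ fa)); rewrite SubK.
    apply/connsetP => Q z; rewrite inE => zu zQ clQ w; rewrite inE => wu.
    suff /imsetP[q qQ /val_inj->//] : val w \in val @: Q.
    apply: (cu _ (val z)); rewrite ?imset_f ?inE // => b c.
    rewrite !inE => bu cu' /imsetP[q qQ bq] bc.
    have cx := neqx _ _ (eqP cu').
    apply/imsetP; exists (Sub c cx); rewrite ?SubK //.
    apply: (clQ q) => //; rewrite ?inE ?SubK // -?bq //.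
    by rewrite /edge /= /del_vertex_rel -bq.
  have [a [b [fa fb ab]]] := fe _ _ uv.
  by exists (Sub a (neqx _ _ fa)), (Sub b (neqx _ _ fb)); rewrite !SubK.
rewrite negb_exists => /forallP fS.
case: (boolP [exists p : G * G, edge p.1 p.2 && (f p.1 == f p.2)]).
  case/existsP=> -[x y] /= /andP[xy /eqP fxy].
  apply: (@minor_contract _ _ x y xy).
  have nxy : x != y by apply: contraTneq xy => ->; rewrite edge_irrefl.
  pose x' : contract x y := Sub x nxy.
  pose pi a : contract x y := insubd x' a.
  have vpi a : val (pi a) = if a == y then x else a.
    by rewrite /pi val_insubd; case: eqP.
  have fpi a : f (val (pi a)) = f a by rewrite vpi; case: eqP => // ->.
  have piK (z : contract x y) : pi (val z) = z by apply: valKd.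
  have epi a b : edge a b -> pi a = pi b \/ edge (pi a) (pi b).
    move=> ab; case: (eqVneq (pi a) (pi b)) => [|nab]; [by left|right].
    rewrite /edge /= /contract_rel nab /= !vpi.
    move: nab; rewrite -val_eqE /= !vpi.
    case: (eqVneq a y) => [ay|ay]; case: (eqVneq b y) => [bY|bY] //.
    - by rewrite eqxx.
    - by move: ab; rewrite ay => ->; rewrite eqxx orbT.
    - by move: ab; rewrite bY edge_sym => ->; rewrite eqxx !orbT.
    - by rewrite ab.
  apply: (IH (contract x y) (fun z => f (val z))).
    rewrite card_sig -ltnS; apply: leq_trans ltm; rewrite ltnS.
    apply: proper_card; apply/properP.
    by split; [apply/subsetP|exists y; rewrite ?inE ?eqxx].
  split=> [u|u v uv].
    have [/connsetP cu [a fa]] := fc u; split; last by exists (pi a); rewrite fpi.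
    apply/connsetP => Q z; rewrite inE => zu zQ clQ w; rewrite inE => wu.
    suff : val w \in [set a | pi a \in Q] by rewrite inE piK.
    apply: (cu _ (val z)); rewrite ?inE ?piK // => b c.
    rewrite !inE => bu cu' bQ bc; case: (epi _ _ bc) => [<-//|].
    by apply: clQ; rewrite ?inE ?fpi.
  have [a [b [fa fb ab]]] := fe _ _ uv.
  exists (pi a), (pi b); rewrite !fpi; split=> //.
  case: (epi _ _ ab) => // pab.
  have : Some u = Some v by rewrite -fa -fb -fpi pab fpi.
  by case=> uvE; rewrite uvE edge_irrefl in uv.
rewrite negb_exists => /forallP nmono.
have fex u : exists x, f x == Some u.
  by have [_ [x fx]] := fc u; exists x; apply/eqP.
(* A connected branch set without inner edges is a single vertex. *)
have finj x y : f x = f y -> x = y.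
  case fx : (f x) => [u|]; last by have := fS x; rewrite fx.
  move=> fy; have [/connsetP cu _] := fc u.
  have /cu : x \in [set x | f x == Some u] by rewrite inE fx.
  move=> cx; suff /set1P-> : y \in [set x] by [].
  apply: (cx _ (set11 x)); last by rewrite inE -fy.
  move=> a b; rewrite !inE => /eqP fa /eqP fb _ ab.
  by have := nmono (a, b); rewrite /= ab fa fb eqxx.
pose g u := xchoose (fex u).
have fg u : f (g u) = Some u by apply/eqP/(xchooseP (fex u)).
apply: (@spanning_minor _ _ g); last first.
  move=> u v /fe[x [y [fx fy xy]]].
  by rewrite (finj (g u) x) ?fg // (finj (g v) y) ?fg.
have fe' x : exists u, f x == Some u.
  by case fx : (f x) => [u|]; [exists u|have := fS x; rewrite fx].
exists (fun x => xchoose (fe' x)) => [u|x].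
  by have /eqP/(etrans (esym (fg u)))[] := xchooseP (fe' (g u)).
by apply: finj; rewrite fg; apply/esym/eqP/(xchooseP (fe' x)).
Qed.

(** Any [#|H|] members serve as branch sets, whatever the edges of [H], since all pairs touch. *)
Lemma covey_minor (H G : sgraph) (CC : {set {set G}}) :
  covey CC -> #|H| <= #|CC| -> minor H G.
Proof.
move=> [c1 c2] HCC.
pose br (u : H) : {set G} := nth set0 (enum CC) (enum_rank u).
have bs (u : H) : enum_rank u < size (enum CC).
  by rewrite -cardE; apply: leq_trans HCC; apply: ltn_ord.
have brC u : br u \in CC by rewrite -mem_enum mem_nth.
have br_inj : injective br.
  move=> u v /eqP; rewrite nth_uniq ?enum_uniq // => /eqP/val_inj.
  exact: enum_rank_inj.
pose f x := [pick u | x \in br u].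
have fE x u : (f x == Some u) = (x \in br u).
  rewrite /f; case: pickP => [v xv|->//]; apply/eqP/idP => [[<-]//|xu].
  congr Some; apply/eqP; apply: contraTT xv => neq.
  have brn : br u != br v by apply: contraNneq neq => /br_inj->.
  have [dis _] := c2 _ _ (brC u) (brC v) brn.
  by rewrite (disjointFr dis xu).
apply: (@model_minor _ _ f); split=> [u|u v uv].
  have -> : [set x | f x == Some u] = br u by apply/setP => x; rewrite inE fE.
  have [cu /set0Pn[x xu]] := c1 _ (brC u); split=> //.
  by exists x; apply/eqP; rewrite fE.
have neq : br u != br v.
  by apply: contraTneq uv => /br_inj->; rewrite edge_irrefl.
have [_ [x [y [xu yv xy]]]] := c2 _ _ (brC u) (brC v) neq.
by exists x, y; split=> //; apply/eqP; rewrite fE.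
Qed.

(** * Mixing assignments across a separator *)

Section Mixing.
Variables (V : eqType) (C : circuit V).

Lemma eval_unique x (val : gate C -> bool) :
  (forall h, val h = gate_op x val h) -> val =1 eval x.
Proof.
move=> valE h; have [m] := ubnP #|[set g | connect (@wire _ C) g h]|.
elim: m h => // m IH h hm; rewrite valE evalE; apply: eq_gate_op => g gh.
apply: IH; rewrite -ltnS; apply: leq_trans hm; rewrite ltnS.
apply/proper_card/properP; split.
  apply/subsetP => k; rewrite !inE => kg.
  exact: connect_trans kg (connect1 gh).
by exists h; rewrite !inE ?connect0 //; apply: wire_acyclic.
Qed.

Definition is_input (v : V) (g : gate C) : bool :=
  if label g is Input u then u == v else false.

Lemma is_inputP v g : reflect (label g = Input v) (is_input v g).
Proof.
rewrite /is_input; case: (label g) => [u|||]; try by constructor.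
by apply: (iffP eqP) => [->|[]].
Qed.

Variables (X L : {set underlying_graph C}).

Definition on_left (v : V) : bool := [exists g in L :|: X, is_input v g].

Definition mix (z z' : V -> bool) (v : V) : bool :=
  if on_left v then z v else z' v.

(** By the read-once property the side of a variable is the side of its only gate. *)
Lemma on_left_label g v : label g = Input v -> on_left v = (g \in L :|: X).
Proof.
move=> gv; apply/exists_inP/idP => [[k kL /is_inputP kv]|gL].
  by rewrite (read_once gv kv).
by exists g; rewrite //; apply/is_inputP.
Qed.

(* The restriction of [val] to [S], extended by the value that is neutral for
   the operation of the gate [h]. *)
Definition restrict (S : {set underlying_graph C}) (h : gate C)
    (val : gate C -> bool) (g : gate C) : bool :=
  if g \in S then val g else if label h is And then true else false.

Definition merge_op (h : gate C) : bool -> bool -> bool :=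
  if label h is Or then orb else andb.

Lemma gate_op_split (S : {set underlying_graph C}) x val h :
  gate_op x val h = merge_op h (gate_op x (restrict S h val) h)
                               (gate_op x (restrict (~: S) h val) h).
Proof.
rewrite /gate_op /merge_op /restrict; case: (label h) => [v|||].
- by rewrite andbb.
- apply/forallP/andP => [vS|[/forallP v1 /forallP v2] g].
    by split; apply/forallP => g; have := vS g; case: ifP; rewrite ?implybT.
  by have := v1 g; have := v2 g; rewrite in_setC; case: (g \in S).
- apply/existsP/orP => [[g]|].
    case gS : (g \in S) => vg; [left|right]; apply/existsP; exists g.
      by rewrite gS.
    by rewrite in_setC gS.
  by case=> /existsP[g]; case: ifP => _; rewrite ?andbF // => vg; exists g.
- apply/forallP/andP => [vS|[/forallP v1 /forallP v2] g].
    by split; apply/forallP => g; have := vS g; case: ifP; rewrite ?implybT.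
  by have := v1 g; have := v2 g; rewrite in_setC; case: (g \in S).
Qed.

(* Two bits per gate of the separator: its value, and the contribution to that
   value of its inputs in [L :|: X]. *)
Definition signature (z : V -> bool) : {ffun 'I_#|X| -> bool * bool} :=
  [ffun i => (eval z (enum_val i),
    gate_op z (restrict (L :|: X) (enum_val i) (eval z)) (enum_val i))].

Hypothesis L_closed : closed_off X L.

(** The claimed values satisfy the gate equations, which determine them. No wire joins [L] to the
    far side, and the assignments agree on [X]. At a gate of [X] the left contributions agree, so
    that of [z] merged with the right one of [z'] gives the common value. *)
Lemma eval_mix z z' : signature z = signature z' ->
  forall g, eval (mix z z') g =
            if g \in L :|: X then eval z g else eval z' g.
Proof.
move=> sig; pose val g := if g \in L :|: X then eval z g else eval z' g.
move=> g; rewrite -/(val g); apply/esym; move: g; apply: eval_unique => h.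
have sigX k : k \in X -> eval z k = eval z' k /\
    gate_op z (restrict (L :|: X) k (eval z)) k =
    gate_op z' (restrict (L :|: X) k (eval z')) k.
  move=> kX; have /ffunP/(_ (enum_rank_in kX k)) := sig.
  by rewrite !ffunE enum_rankK_in // => -[-> ->].
have [[v hv]|hV] :
    (exists v, label h = Input v) \/ (forall v, label h <> Input v).
- by case: (label h) => [v|||]; [left; exists v|right..].
- rewrite /val /gate_op hv /mix (on_left_label hv).
  by case: ifP => _; rewrite evalE /gate_op hv.
have opx x x' val' : gate_op x val' h = gate_op x' val' h.
  by rewrite /gate_op; case: (label h) hV => // v /(_ v).
have [hX|hX] := boolP (h \in X).
  have [ez ep] := sigX _ hX.
  have lr (k : gate C) : k \in L :|: X -> val k = eval z k.
    by rewrite /val => ->.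
  have rr (k : gate C) : k \notin L :|: X -> val k = eval z' k.
    by rewrite /val => /negbTE->.
  have pl : gate_op (mix z z') (restrict (L :|: X) h val) h =
            gate_op z (restrict (L :|: X) h (eval z)) h.
    rewrite (opx _ z); apply: eq_gate_op => k _; rewrite /restrict.
    by case: ifP => // /lr.
  have pr : gate_op (mix z z') (restrict (~: (L :|: X)) h val) h =
            gate_op z' (restrict (~: (L :|: X)) h (eval z')) h.
    rewrite (opx _ z'); apply: eq_gate_op => k _; rewrite /restrict in_setC.
    by case: ifP => // /rr.
  rewrite (gate_op_split (L :|: X)) pl pr lr; last by rewrite in_setU hX orbT.
  have := ez; rewrite evalE [in RHS]evalE !(gate_op_split (L :|: X) _ (eval _)) ep.
  move: (gate_op z' _ h) (gate_op z _ h) (gate_op z' _ h).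
  by rewrite /merge_op; case: (label h) => [v|||] [] [] [].
have [hL|hL] := boolP (h \in L).
  rewrite /val in_setU hL /= -/val evalE (opx _ (mix z z')).
  apply: eq_gate_op => k kh; rewrite /val in_setU.
  case kX : (k \in X); rewrite ?orbT // (closed_offP _ _ L_closed h) ?kX //.
  by rewrite /edge /= /underlying_rel kh orbT.
rewrite {1}/val in_setU (negbTE hL) (negbTE hX) /= evalE (opx _ (mix z z')).
apply: eq_gate_op => k kh; rewrite /val in_setU.
case kX : (k \in X); first by rewrite orbT (sigX _ kX).1.
rewrite orbF ifN //; apply: contra hL => kL.
by apply: (closed_offP _ _ L_closed k) => //; rewrite /edge /= /underlying_rel kh.
Qed.

Lemma fooling_bound f b (I : finType) (A : {set I}) (fam : I -> V -> bool) :
  computes C f -> (forall i, i \in A -> f (fam i) = b) ->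
  (forall i j, i \in A -> j \in A -> i != j ->
     f (mix (fam i) (fam j)) != b \/ f (mix (fam j) (fam i)) != b) ->
  #|A| <= 4 ^ #|X|.
Proof.
move=> Cf fb fmix.
have sig_inj : {in A &, injective (signature \o fam)}.
  move=> i j iA jA /= sij; apply/eqP; apply: contraT => nij.
  have [] := fmix i j iA jA nij; rewrite -Cf eval_mix //.
    by case: ifP; rewrite Cf fb // eqxx.
  by case: ifP; rewrite Cf fb // eqxx.
rewrite -(card_in_imset sig_inj); apply: leq_trans (max_card _) _.
by rewrite card_ffun card_prod card_bool card_ord.
Qed.

End Mixing.

(** A circuit may omit input gates; this forces one for each variable that matters. *)
Lemma relevant_input (V : eqType) (C : circuit V) f (x x' : V -> bool) (v : V) :
  computes C f -> (forall u, u != v -> x u = x' u) -> f x != f x' ->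
  exists g : gate C, label g = Input v.
Proof.
move=> Cf xx' fx; case: (boolP [exists g : gate C, is_input v g]).
  by case/existsP=> g /is_inputP; exists g.
rewrite negb_exists => /forallP ng; case/eqP: fx; rewrite -!Cf.
apply: (@eval_unique V C x' (eval x)) => h; rewrite evalE /gate_op.
case hu : (label h) => [u|||] //; apply: xx'.
by apply: contraNneq (ng h) => <-; apply/is_inputP.
Qed.

(** * A fooling set for triangle-freeness *)

Section Adjacency.
Variable n : nat.
Implicit Types (x : edge_var n -> bool) (u v w : 'I_n) (q : rel 'I_n).

Lemma adjacentC x u v : adjacent x u v = adjacent x v u.
Proof. by apply: eq_existsb => e; rewrite orbC. Qed.

Lemma adjacent_var u v : u != v ->
  exists e : edge_var n, (val e = (u, v) \/ val e = (v, u)) /\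
    forall x, adjacent x u v = x e.
Proof.
wlog uv : u v / u < v => [hw|] neq.
  have [|vu|uv] := ltngtP u v; first by move/hw; apply.
    have [|e [ve xe]] := hw _ _ vu; first by rewrite eq_sym.
    by exists e; split=> [|x]; [case: ve; [right|left]|rewrite adjacentC].
  by case/eqP: neq; apply: val_inj.
exists (Sub (u, v) uv); split=> [|x]; first by left; rewrite SubK.
apply/existsP/idP => [[e /andP[xe]]|xe]; last first.
  by exists (Sub (u, v) uv); rewrite xe SubK eqxx.
case/orP=> /eqP ve.
  by rewrite (_ : Sub _ _ = e) //; apply: val_inj; rewrite SubK.
by have := valP e; rewrite ve /= ltnNge ltnW.
Qed.

Lemma adjacent_irrefl x u : adjacent x u u = false.
Proof.
by apply/negbTE/existsPn => e; apply/negP => /andP[_]; rewrite orbb => /eqP eu;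
   have := valP e; rewrite eu ltnn.
Qed.

Definition of_rel q : edge_var n -> bool := fun e => q (val e).1 (val e).2.

Lemma adjacent_of_rel q u v : symmetric q ->
  adjacent (of_rel q) u v = (u != v) && q u v.
Proof.
move=> sq; have [->|neq] := eqVneq u v; first by rewrite adjacent_irrefl.
have [e [ve ->]] := adjacent_var neq.
by rewrite /of_rel; case: ve => -> //=; rewrite sq.
Qed.

Lemma no_triangle_free x :
  (forall u v w, adjacent x u v -> adjacent x v w -> adjacent x u w -> False) ->
  triangle_free x.
Proof.
move=> no; apply/negP => /existsP[u /existsP[v /existsP[w /and3P[]]]].
exact: no.
Qed.

Lemma triangle_not_free x u v w :
  adjacent x u v -> adjacent x v w -> adjacent x u w -> ~~ triangle_free x.
Proof.
move=> uv vw uw; rewrite negbK; apply/existsP; exists u; apply/existsP.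
by exists v; apply/existsP; exists w; rewrite uv vw.
Qed.

Lemma variable_has_gate (C : circuit (edge_var n)) u v : 2 < n ->
  computes C (@triangle_free n) -> u != v ->
  exists (g : gate C) (e : edge_var n),
    label g = Input e /\ (val e = (u, v) \/ val e = (v, u)).
Proof.
move=> n2 Cf neq; have [e [ve xe]] := adjacent_var neq.
have [w wuv] : exists w, w \notin [set u; v].
  apply/existsP; rewrite -negb_forall; apply: contraL n2 => /forallP uvT.
  rewrite -leqNgt -[n in n <= _]card_ord -cardsT.
  apply: leq_trans (_ : #|[set u; v]| <= 2); last by rewrite cards2; case: eqP.
  by apply: subset_leq_card; apply/subsetP => w _.
have [wu wv] : w != u /\ w != v.
  by apply/andP; rewrite -negb_or; rewrite !inE in wuv.
(* The star centred at [w] has no triangle; adding the edge [u v] closes one. *)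
pose q a b := (a == w) (+) (b == w).
have sq : symmetric q by move=> a b; rewrite /q addbC.
pose x' f := (f == e) || of_rel q f.
have sub a b : adjacent (of_rel q) a b -> adjacent x' a b.
  by case/existsP=> f /andP[xf ab]; apply/existsP; exists f; rewrite /x' xf orbT.
have [||g ge] := @relevant_input _ C _ (of_rel q) x' e Cf;
    last by exists g, e.
  by move=> f /negbTE fe; rewrite /x' fe.
have -> : triangle_free (of_rel q).
  apply: no_triangle_free => a b c; rewrite !adjacent_of_rel //.
  by move=> /andP[_ +] /andP[_ +] /andP[_]; rewrite /q; do 3!case: (_ == w).
rewrite eq_sym eqb_id; apply: (@triangle_not_free x' u v w).
- by rewrite xe /x' eqxx.
- apply: sub; rewrite adjacent_of_rel // eq_sym wv.
  by rewrite /q eqxx (eq_sym v) (negbTE wv).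
apply: sub; rewrite adjacent_of_rel // eq_sym wu.
by rewrite /q eqxx (eq_sym u) (negbTE wu).
Qed.

End Adjacency.

Section Fooling.
Variables (n : nat) (C : circuit (edge_var n)).
Variables (X L : {set underlying_graph C}) (I : finType).
Variables (al be : I -> 'I_n) (sg : I -> I).
Hypothesis Cf : computes C (@triangle_free n).
Hypothesis L_closed : closed_off X L.
Hypothesis al_inj : injective al.
Hypothesis be_inj : injective be.
Hypothesis al_be : forall i j, al i != be j.
Hypothesis sgK : involutive sg.

Let a i j := adjacent (on_left X L) (al i) (be j).
(** The cherries with centre [be j] whose edge to [al i] is on the left and whose edge to
    [al (sg i)] is on the right. *)
Let P := [set p : I * I | a p.1 p.2 && ~~ a (sg p.1) p.2].

Let matched : rel 'I_n := fun u v => [exists i, (u == al i) && (v == al (sg i))].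

(** A cherry in [T] contributes its left edge, a cherry of [P] outside [T] its right edge. *)
Let crossing (T : {set I * I}) (i j : I) : bool :=
  ((i, j) \in T) || ((sg i, j) \in P :\: T).

Let crossed T : rel 'I_n := fun u v => [exists p : I * I, crossing T p.1 p.2 &&
  (((u == al p.1) && (v == be p.2)) || ((u == be p.2) && (v == al p.1)))].

Let graph T := of_rel (fun u v => matched u v || crossed T u v).

Let matchedC : symmetric matched.
Proof.
suff half u v : matched u v -> matched v u.
  by move=> u v; apply/idP/idP; apply: half.
case/existsP=> i /andP[/eqP-> /eqP->]; apply/existsP; exists (sg i).
by rewrite sgK !eqxx.
Qed.

Let crossedC T : symmetric (crossed T).
Proof.
move=> u v; apply: eq_existsb => p.
by rewrite orbC [(_ == al _) && _]andbC [(_ == be _) && _]andbC.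
Qed.

Let graph_adj T u v :
  adjacent (graph T) u v = (u != v) && (matched u v || crossed T u v).
Proof. by rewrite adjacent_of_rel // => {}u {}v; rewrite matchedC crossedC. Qed.

Let crossedP T u v : crossed T u v ->
  exists i j, crossing T i j /\ (u = al i /\ v = be j \/ u = be j /\ v = al i).
Proof.
case/existsP=> -[i j] /= /andP[cij /orP[]/andP[/eqP-> /eqP->]];
  exists i, j; split=> //.
  by left.
by right.
Qed.

Let crossing_excl (T : {set I * I}) i j : T \subset P ->
  crossing T i j -> crossing T (sg i) j -> False.
Proof.
move=> /subsetP TP; rewrite /crossing sgK.
have Pex : (i, j) \in P -> (sg i, j) \in P -> False.
  by rewrite !inE /= => /andP[_ /negbTE->].
move=> /orP[ijT|/setDP[sP sT]] /orP[sT'|/setDP[iP iT]].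
- by apply: Pex; apply: TP.
- by rewrite ijT in iT.
- by rewrite sT' in sT.
- exact: Pex.
Qed.

Let al_neq_be i j : al i = be j -> False.
Proof. by move/eqP; rewrite (negbTE (al_be i j)). Qed.

(** Two matching edges never share just one vertex, a single one would need both edges of a cherry,
    and the crossing edges alone form a bipartite graph. *)
Let graph_triangle_free (T : {set I * I}) :
  T \subset P -> triangle_free (graph T).
Proof.
move=> TP; apply: no_triangle_free => u v w.
have MM u1 v1 w1 : matched u1 v1 -> matched v1 w1 -> u1 = w1.
  move=> /existsP[i /andP[/eqP-> /eqP->]].
  move=> /existsP[k /andP[/eqP/al_inj<- /eqP->]].
  by rewrite sgK.
have MXX u1 v1 w1 :
    matched u1 v1 -> crossed T u1 w1 -> crossed T v1 w1 -> False.
  move=> /existsP[i /andP[/eqP-> /eqP->]] /crossedP[k [j [ckj uk]]].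
  move=> /crossedP[k' [j' [ckj' uk']]].
  case: uk => -[]; last by move/al_neq_be.
  move=> /al_inj ki w1E; subst k w1.
  case: uk' => -[]; last by move/al_neq_be.
  move=> /al_inj ki' /be_inj jj; subst k' j'.
  exact: crossing_excl ckj ckj'.
have XXX u1 v1 w1 :
    crossed T u1 v1 -> crossed T v1 w1 -> crossed T u1 w1 -> False.
  move=> /crossedP[k [j [_ uk]]] /crossedP[k' [j' [_ uk']]].
  move=> /crossedP[k2 [j2 [_ uk2]]].
  have ne i1 j1 : be j1 = al i1 -> False by move/esym/al_neq_be.
  by case: uk => -[? ?]; case: uk' => -[? ?]; case: uk2 => -[? ?]; subst;
    (apply: al_neq_be; by eauto) || (apply: ne; by eauto).
rewrite !graph_adj => /andP[/eqP uv /orP[Muv|Xuv]]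
  /andP[/eqP vw /orP[Mvw|Xvw]] /andP[/eqP uw /orP[Muw|Xuw]].
- exact/uw/(MM _ _ _ Muv Mvw).
- exact/uw/(MM _ _ _ Muv Mvw).
- by apply/vw/(MM v u w) => //; rewrite matchedC.
- exact: MXX Muv Xuw Xvw.
- by apply/uv/(MM u w v) => //; rewrite matchedC.
- by apply: (MXX v w u) => //; rewrite crossedC.
- by apply: (MXX u w v) => //; rewrite crossedC.
- exact: XXX Xuv Xvw Xuw.
Qed.

Let adjacent_mix x x' u v : u != v ->
  adjacent (mix X L x x') u v =
  if adjacent (on_left X L) u v then adjacent x u v else adjacent x' u v.
Proof. by move=> /adjacent_var[e [_ xe]]; rewrite !xe. Qed.

(** The left edge of the cherry [p] comes from [T], its right edge from [T'], and the matching edge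
    is present in both graphs. *)
Let mix_triangle (T T' : {set I * I}) p : T \subset P -> T' \subset P ->
  p \in T -> p \notin T' ->
  triangle_free (mix X L (graph T) (graph T')) != true.
Proof.
case: p => i j TP T'P pT pT'; rewrite eqb_id.
have := subsetP TP _ pT; rewrite inE /= => /andP[aij asij].
have isi : i != sg i by apply: contraTneq aij => {1}->.
have M : matched (al i) (al (sg i)) by apply/existsP; exists i; rewrite !eqxx.
have aa : al i != al (sg i) by rewrite inj_eq.
apply: (@triangle_not_free _ _ (al i) (al (sg i)) (be j));
  rewrite adjacent_mix // -?/(a i j) -?/(a (sg i) j)
    ?aij ?(negbTE asij) !graph_adj.
- by rewrite M aa; case: ifP.
- rewrite al_be; apply/orP; right; apply/existsP; exists (sg i, j).
  by rewrite !eqxx /crossing sgK in_setD pT' (subsetP TP _ pT) orbT.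
- rewrite al_be; apply/orP; right; apply/existsP; exists (i, j).
  by rewrite !eqxx /crossing pT.
Qed.

(** The graphs of the [2 ^ #|P|] subsets of [P] form a fooling set, so there are at most [4 ^ #|X|]
    of them. *)
Lemma split_cherries : #|P| <= 2 * #|X|.
Proof.
rewrite -(@leq_exp2l 2) // expnM -card_powerset.
apply: (fooling_bound (fam := graph) L_closed Cf (b := true)) => [T|T T'].
  by rewrite inE; apply: graph_triangle_free.
rewrite !inE => TP T'P nTT'.
have [TT'|] := boolP (T \subset T'); last first.
  by case/subsetPn=> p pT pT'; left; apply: mix_triangle pT pT'.
have : ~~ (T' \subset T) by apply: contra nTT' => T'T; rewrite eqEsubset TT'.
by case/subsetPn=> p pT pT'; right; apply: mix_triangle pT pT'.
Qed.

End Fooling.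

(** * Counting cherries *)

Lemma card_pairs (I J : finType) (Q : I -> J -> bool) :
  #|[set p : I * J | Q p.1 p.2]| = \sum_i \sum_j Q i j.
Proof.
rewrite pair_bigA -sum1_card big_mkcond /=; apply: eq_bigr => p _.
by rewrite inE; case: (Q _ _).
Qed.

(** A pair [(i, i')] belongs to exactly one reflection, the one with [s = i + i']. *)
Lemma sum_reflections (I : finZmodType) (F : I -> I -> nat) :
  \sum_s \sum_i F i (s - i)%R = \sum_i \sum_i' F i i'.
Proof.
rewrite exchange_big; apply: eq_bigr => i _ /=.
rewrite (reindex_inj (addIr i)) /=; apply: eq_bigr => s _.
by rewrite addrK.
Qed.

(* Given [a i j] and [~~ a i' j'], the entry [a i' j] closes a cherry in column
   [j] if it is false and in row [i'] if it is true. *)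
Lemma cherry_count (I : finZmodType) (a : I -> I -> bool) (b : nat) :
  (forall s, #|[set p : I * I | a p.1 p.2 && ~~ a (s - p.1)%R p.2]| <= b) ->
  (forall s, #|[set p : I * I | a p.2 p.1 && ~~ a p.2 (s - p.1)%R]| <= b) ->
  #|[set p : I * I | a p.1 p.2]| * #|[set p : I * I | ~~ a p.1 p.2]| <=
    2 * #|I| ^ 2 * b.
Proof.
move=> hcol hrow; pose m := #|I|.
have bound (F : I -> I -> I -> bool) :
    (forall s, #|[set p : I * I | F p.1 (s - p.1)%R p.2]| <= b) ->
    \sum_i \sum_i' \sum_j F i i' j <= m * b.
  move=> hF; rewrite -(sum_reflections (fun i i' => \sum_j F i i' j)).
  rewrite -sum_nat_const; apply: leq_sum => s _.
  by rewrite -(card_pairs (fun i j => F i (s - i)%R j)).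
have col := bound (fun i i' j => a i j && ~~ a i' j) hcol.
have row := bound (fun j j' i => a i j && ~~ a i j') hrow.
rewrite !card_pairs (card_pairs (fun i j => ~~ a i j)).
apply: (@leq_trans (\sum_i \sum_j \sum_i' \sum_j'
    ((a i j && ~~ a i' j) + (a i' j && ~~ a i' j')))).
  rewrite big_distrl; apply: leq_sum => i _.
  rewrite big_distrl; apply: leq_sum => j _.
  rewrite big_distrr; apply: leq_sum => i' _.
  rewrite big_distrr; apply: leq_sum => j' _ /=.
  by case: (a i j); case: (a i' j); case: (a i' j').
under eq_bigr => i _ do under eq_bigr => j _ do
  under eq_bigr => i' _ do rewrite big_split /= sum_nat_const.
under eq_bigr => i _ do under eq_bigr => j _ do
  rewrite big_split /= -big_distrr /=.
under eq_bigr => i _ do rewrite big_split /= -big_distrr /=.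
rewrite big_split /= -big_distrr /= sum_nat_const -/m.
have -> : \sum_i \sum_j \sum_i' (a i j && ~~ a i' j) =
          \sum_i \sum_i' \sum_j (a i j && ~~ a i' j).
  by apply: eq_bigr => i _; rewrite exchange_big.
have -> : \sum_j \sum_i' \sum_j' (a i' j && ~~ a i' j') =
          \sum_j \sum_j' \sum_i' (a i' j && ~~ a i' j').
  by apply: eq_bigr => i _; rewrite exchange_big.
(* In each sum one index is free and gives a factor [m]; the [m] reflections give the other. *)
apply: (@leq_trans (m * (m * b) + m * (m * b))).
  by rewrite leq_add // leq_mul2l ?col ?row orbT.
rewrite -mulnn; lia.
Qed.

(** * The lower bound on the separator and on the circuit *)

Section Bound.
Variables (n : nat) (H : sgraph) (C : circuit (edge_var n)) (k r : nat).
Hypothesis Cf : computes C (@triangle_free n).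
Hypothesis n_gt2 : 2 < n.
Hypothesis kn : k.+1 + k.+1 <= n.
Hypothesis C_free : minor_free C H.
Hypothesis r_gt0 : 0 < r.
Hypothesis r_large : #|H| * #|gate C| <= r ^ 2.

Let I : finZmodType := 'I_k.+1.
Let alP (i : I) : i < n.
Proof. by apply: leq_trans kn; apply: leq_trans (ltn_ord i) (leq_addr _ _). Qed.
Let beP (j : I) : k.+1 + j < n.
Proof. by apply: leq_trans kn; rewrite ltn_add2l ltn_ord. Qed.
Let al (i : I) : 'I_n := Ordinal (alP i).
Let be (j : I) : 'I_n := Ordinal (beP j).

Lemma separator_bound : k.+1 ^ 2 <= 64 * (#|H| * r).
Proof.
have al_inj : injective al by move=> i j [] /val_inj.
have be_inj : injective be by move=> i j [] /addnI /val_inj.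
have al_be i j : al i != be j.
  by rewrite -val_eqE /= neq_ltn (leq_trans (ltn_ord i)) ?leq_addr.
have be_al i j : be i != al j by rewrite eq_sym.
have gam_ex (p : I * I) : exists g : gate C, [exists e, is_input e g &&
    ((val e == (al p.1, be p.2)) || (val e == (be p.2, al p.1)))].
  have [g [e [ge ve]]] := variable_has_gate n_gt2 Cf (al_be p.1 p.2).
  exists g; apply/existsP; exists e; apply/andP; split; first exact/is_inputP.
  by case: ve => ->; rewrite eqxx ?orbT.
pose gam p : underlying_graph C := xchoose (gam_ex p).
have gamP p : exists e, label (gam p : gate C) = Input e /\
    (val e = (al p.1, be p.2) \/ val e = (be p.2, al p.1)).
  have /existsP[e /andP[/is_inputP ge ve]] := xchooseP (gam_ex p).
  by exists e; split=> //; case/orP: ve => /eqP; [left|right].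
have gam_inj : injective gam.
  move=> [i j] [i' j'] eqg; have [e [ge ve]] := gamP (i, j).
  have [e' [ge' ve']] := gamP (i', j').
  move: ge'; rewrite -eqg ge => -[ee']; rewrite -ee' /= in ve'.
  case: ve ve' => -> /= [] [] =>
    [/val_inj-> /addnI/val_inj->//|e1 _|e1 _|/addnI/val_inj-> /val_inj->//].
    by have := al_be i j'; rewrite -val_eqE /= e1 eqxx.
  by have := be_al j i'; rewrite -val_eqE /= e1 eqxx.
have [CC cov|X [Xr light]] :=
  @light_separator (underlying_graph C) _ gam r #|H| r_gt0 r_large.
  rewrite ltnNge; apply/negP => HCC.
  by apply: C_free; apply: covey_minor cov HCC.
have cardII : #|{: I * I}| = k.+1 ^ 2 by rewrite card_prod card_ord mulnn.
(* A separator too large for a balanced division already satisfies the bound. *)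
case: (leqP (4 * #|X|) #|{: I * I}|) => [X4|]; last by rewrite cardII; lia.
have [L [LX clL wL wR]] := balanced_split gam_inj light X4.
pose a (i j : I) := adjacent (on_left X L) (al i) (be j).
have aE i j : a i j = (gam (i, j) \in L :|: X).
  have [e [ge ve]] := gamP (i, j); rewrite -(on_left_label X L ge).
  have [e' [_ xe']] := adjacent_var (al_be i j).
  have : adjacent (pred1 e) (al i) (be j).
    apply/existsP; exists e; rewrite /= eqxx.
    by case: ve => ->; rewrite eqxx ?orbT.
  by rewrite /a !xe' => /eqP->.
have subK s : involutive (fun i : I => s - i)%R.
  by move=> i; rewrite opprB addrC subrK.
have cc :
  #|[set p : I * I | a p.1 p.2]| * #|[set p : I * I | ~~ a p.1 p.2]| <=
    2 * #|I| ^ 2 * (2 * #|X|).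
  apply: cherry_count => s.
    exact: (split_cherries Cf clL al_inj be_inj al_be (subK s)).
  (* Cherries in rows are cherries in columns with the two vertex sets exchanged. *)
  have := split_cherries Cf clL be_inj al_inj be_al (subK s).
  congr (_ <= _); apply: eq_card => p; rewrite !inE /a.
  by rewrite (adjacentC _ (be p.1)) (adjacentC _ (be (s - p.1)%R)).
have wT : k.+1 ^ 2 <= 4 * #|[set p : I * I | a p.1 p.2]|.
  rewrite -cardII; apply: leq_trans wL _; rewrite leq_mul2l /=.
  apply: subset_leq_card; apply/subsetP => -[i j]; rewrite !inE aE => gL.
  by rewrite in_setU gL.
have wF : k.+1 ^ 2 <= 4 * #|[set p : I * I | ~~ a p.1 p.2]|.
  rewrite -cardII; apply: leq_trans wR _; rewrite leq_mul2l /=.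
  apply: subset_leq_card; apply/subsetP => -[i j].
  by rewrite !inE aE in_setU.
move: cc; rewrite card_ord => cc.
have : k.+1 ^ 2 * k.+1 ^ 2 <= 16 * (2 * k.+1 ^ 2 * (2 * #|X|)).
  apply: leq_trans (leq_mul wT wF) _; rewrite mulnACA leq_mul2l /=; exact: cc.
have -> : 16 * (2 * k.+1 ^ 2 * (2 * #|X|)) = k.+1 ^ 2 * (64 * #|X|) by lia.
rewrite leq_pmul2l ?expn_gt0 // => /leq_trans; apply.
by rewrite leq_mul2l Xr.
Qed.
End Bound.

(** The least [r] with [M <= r ^ 2] works: if [r > 1], then [r <= 2 * (r - 1)] and
    [(r - 1) ^ 2 < M]. *)
Lemma sqrt_approx (M : nat) : 0 < M ->
  exists r, [/\ 0 < r, M <= r ^ 2 & r ^ 2 <= 4 * M].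
Proof.
move=> M0; have ex : exists r, M <= r ^ 2 by exists M; rewrite -mulnn leq_pmull.
case: (ex_minnP ex) => -[|r] Mr minr; first by rewrite leqn0 in Mr; lia.
exists r.+1; split=> //; case: (posnP r) => [->|r0]; first by lia.
have : r ^ 2 < M by rewrite ltnNge; apply/negP => /minr; rewrite ltnn.
by rewrite -!mulnn; nia.
Qed.

Local Open Scope ring_scope.

Theorem theorem10 (R : realType) (H : sgraph) :
  exists2 c : R, 0 < c &
    forall (n : nat) (C : circuit (edge_var n)),
      minor_free C H -> computes C (@triangle_free n) ->
      c * n%:R ^+ 4 <= #|gate C|%:R.
Proof.
(* 16 covers [n <= 2]; 81 comes from [n <= 3 * k.+1], [64 ^ 2 * #|H| ^ 2] from squaring
   [separator_bound], and [4 * #|H|] from [r ^ 2 <= 4 * (#|H| * #|gate C|)]. *)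
pose D := (16 + 81 * 64 ^ 2 * 4 * #|H| ^ 3)%N.
have D0 : (0 : R) < D%:R by rewrite ltr0n.
exists D%:R^-1; first by rewrite invr_gt0.
move=> n C Cfree Cf; rewrite ler_pdivrMl // -natrX -natrM ler_nat.
have N0 : (0 < #|gate C|)%N by apply/card_gt0P; exists (output C).
have [n2|n2] := leqP n 2.
  apply: (@leq_trans (2 ^ 4 * 1)%N); last by rewrite leq_mul // leq_addr.
  by rewrite muln1 leq_exp2r.
have H0 : (0 < #|H|)%N.
  rewrite lt0n; apply/negP => /eqP H0; apply: Cfree.
  apply: (@covey_minor H _ set0); last by rewrite H0.
  by split=> [?|? ?]; rewrite inE.
have [|r [r0 rl ru]] := @sqrt_approx (#|H| * #|gate C|).
  by rewrite muln_gt0 H0.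
(* Both vertex sets have [n./2] elements, written as a successor so that ['I_k.+1] is a group. *)
pose k := (n./2).-1.
have k1 : k.+1 = n./2 by rewrite prednK // half_gt0 ltnW.
have kn : (k.+1 + k.+1 <= n)%N.
  by rewrite k1 addnn -[in X in (_ <= X)%N](odd_double_half n) leq_addl.
have nk : (n <= 3 * k.+1)%N.
  by rewrite -(odd_double_half n) -k1; case: (odd n); lia.
have bnd := separator_bound Cf n2 kn Cfree r0 rl.
apply: (@leq_trans ((3 * k.+1) ^ 4)%N); first by rewrite leq_exp2r.
rewrite expnMn (expnM k.+1 2 2).
apply: (@leq_trans (3 ^ 4 * (64 * (#|H| * r)) ^ 2)%N).
  by rewrite leq_mul2l leq_exp2r.
rewrite !expnMn.
apply: (@leq_trans
  (3 ^ 4 * (64 ^ 2 * (#|H| ^ 2 * (4 * (#|H| * #|gate C|)))))%N).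
  by rewrite !leq_mul2l ru !orbT.
rewrite /D mulnDl; apply: leq_trans (leq_addl _ _).
by apply: eq_leq; rewrite !expnS; lia.
Qed.
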